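(* For every mixed fair division instance $([n],[m],\mathcal{V})$ with objective (additive) valuations, an EQ1 (complete) allocation exists, and one can be computed in polynomial time.
   Context: A (mixed) fair division instance $([n],[m],\mathcal{V})$ consists of $n$ agents, a set $O=[m]$ of $m$ indivisible items, and valuations $\mathcal{V}=\{v_1,\dots,v_n\}$ with $v_i:2^{[m]}\to\mathbb{Z}$ additive: $v_i(S)=\sum_{o\in S}v_i(o)$. Values may be positive, negative or zero. A (complete) allocation $A=(A_1,\dots,A_n)$ is a partition of the set of all items into $n$ (possibly empty) bundles, $A_i$ going to agent $i$. An item $o$ is an objective good if $v_i(o)\ge 0$ for all agents $i$, and an objective chore if $v_i(o)\le 0$ for all agents $i$. The instance has objective valuations if every item is an objective good or an objective chore. An allocation $A$ is EQ1 (equitable up to one item) if for every pair of agents $i,j$ with $v_i(A_i)<v_j(A_j)$, either there exists $g\in A_j$ with $v_j(g)\ge 0$ such that $v_i(A_i)\ge v_j(A_j\setminus\{g\})$, or there exists $c\in A_i$ with $v_i(c)\le 0$ such that $v_i(A_i\setminus\{c\})\ge v_j(A_j)$. *)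

(* Defs.v *)
From mathcomp Require Import all_boot all_order all_algebra.

Set Implicit Arguments.
Unset Strict Implicit.
Unset Printing Implicit Defensive.

Import Order.TTheory GRing.Theory Num.Theory.

Local Open Scope ring_scope.

(* An additive valuation is given by its values on single items; its extension
   to sets of items is [bundle_value]. *)
Record instance := Instance {
  agents : nat;
  items : nat;
  value : 'I_agents -> 'I_items -> int
}.

Definition bundle_value (I : instance) (i : 'I_(agents I))
    (S : {set 'I_(items I)}) : int :=
  \sum_(o in S) value i o.

Definition objective_good (I : instance) (o : 'I_(items I)) : Prop :=
  forall i : 'I_(agents I), 0 <= value i o.

Definition objective_chore (I : instance) (o : 'I_(items I)) : Prop :=
  forall i : 'I_(agents I), value i o <= 0.

Definition objective_valuations (I : instance) : Prop :=
  forall o : 'I_(items I), objective_good o \/ objective_chore o.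

Definition bundles (I : instance) : Type := 'I_(agents I) -> {set 'I_(items I)}.

(* Bundles may be empty, so this is not [finset.partition]. *)
Definition complete_allocation (I : instance) (A : bundles I) : Prop :=
  (forall i j, i != j -> [disjoint A i & A j]) /\
  \bigcup_i A i = [set: 'I_(items I)].

Definition EQ1 (I : instance) (A : bundles I) : Prop :=
  forall i j : 'I_(agents I),
    bundle_value i (A i) < bundle_value j (A j) ->
    (exists g, [/\ g \in A j, 0 <= value j g
                 & bundle_value j (A j :\ g) <= bundle_value i (A i)]) \/
    (exists c, [/\ c \in A i, value i c <= 0
                 & bundle_value j (A j) <= bundle_value i (A i :\ c)]).

(* Polynomial time is measured on the random access machine of Cook and Reckhow
   (Time bounded random access machines, 1973) under the logarithmic cost
   criterion, which is polynomially equivalent to multitape Turing machines.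
   Registers X_0, X_1, ... hold integers of unbounded size. *)
Inductive ram_instr :=
| RConst of nat & int          (* X_i <- c *)
| RAdd of nat & nat & nat      (* X_i <- X_j + X_k *)
| RSub of nat & nat & nat      (* X_i <- X_j - X_k *)
| RLoad of nat & nat           (* X_i <- X_(X_j) *)
| RStore of nat & nat          (* X_(X_i) <- X_j *)
| RJumpPos of nat & nat        (* go to instruction l if X_j > 0 *)
| RRead of nat                 (* X_i <- next input integer *)
| RPrint of nat.               (* append X_i to the output *)

Definition ram_program : Type := seq ram_instr.

Record ram_state := RamState {
  ram_pc : nat;
  ram_reg : nat -> int;
  ram_in : seq int;
  ram_out : seq int
}.

(* Number of binary digits of |z|, and 1 for z = 0. *)
Definition bit_length (z : int) : nat := (trunc_log 2 `|z|%N).+1.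

Definition bit_size (s : seq int) : nat := (\sum_(z <- s) bit_length z)%N.

Definition set_reg (r : nat -> int) (i : nat) (z : int) : nat -> int :=
  fun k => if k == i then z else r k.

Definition ram_exec (c : ram_instr) (s : ram_state) : option (nat * ram_state) :=
  let: RamState pc r inp out := s in
  let next r' := RamState pc.+1 r' inp out in
  match c with
  | RConst i z => Some (bit_length z, next (set_reg r i z))
  | RAdd i j k =>
      Some ((bit_length (r j) + bit_length (r k))%N,
            next (set_reg r i (r j + r k)))
  | RSub i j k =>
      Some ((bit_length (r j) + bit_length (r k))%N,
            next (set_reg r i (r j - r k)))
  | RLoad i j =>
      if r j is Posz a then
        Some ((bit_length (r j) + bit_length (r a))%N,
              next (set_reg r i (r a)))
      else None
  | RStore i j =>
      if r i is Posz a then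
        Some ((bit_length (r i) + bit_length (r j))%N,
              next (set_reg r a (r j)))
      else None
  | RJumpPos l j =>
      Some (bit_length (r j), RamState (if 0 < r j then l else pc.+1) r inp out)
  | RRead i =>
      if inp is z :: inp' then
        Some (bit_length z, RamState pc.+1 (set_reg r i z) inp' out)
      else None
  | RPrint i =>
      Some (bit_length (r i), RamState pc.+1 r inp (rcons out (r i)))
  end.

(* [None] on a state whose program counter lies outside the program (normal
   halt), and on a faulty instruction: negative address or exhausted input. *)
Definition ram_step (P : ram_program) (s : ram_state)
    : option (nat * ram_state) :=
  if onth P (ram_pc s) is Some c then ram_exec c s else None.

(* [ram_run P s t out]: started in s, the program P halts normally after steps
   of total cost t, with output out; faulty computations have no run. *)
Inductive ram_run (P : ram_program) : ram_state -> nat -> seq int -> Prop :=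
| RamHalt s : (size P <= ram_pc s)%N -> ram_run P s 0 (ram_out s)
| RamStep s c s' t out :
    ram_step P s = Some (c, s') -> ram_run P s' t out ->
    ram_run P s (c + t)%N out.

Definition ram_init (inp : seq int) : ram_state :=
  RamState 0 (fun _ => 0) inp [::].

Definition poly_time_solvable (T : Type) (valid : T -> Prop)
    (encode : T -> seq int) (solution : T -> seq int -> Prop) : Prop :=
  exists (P : ram_program) (p : {poly nat}),
    forall x : T, valid x ->
    exists (t : nat) (out : seq int),
      [/\ ram_run P (ram_init (encode x)) t out,
          (t <= p.[bit_size (encode x)])%N
        & solution x out].

(* n, m, then v_1(1), ..., v_1(m), ..., v_n(1), ..., v_n(m). *)
Definition encode_instance (I : instance) : seq int :=
  [:: (agents I)%:Z, (items I)%:Z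
    & [seq value i o | i <- enum 'I_(agents I), o <- enum 'I_(items I)]].

(* An allocation is output as the list of the owners of items 0, ..., m - 1. *)
Definition encodes_allocation (I : instance) (A : bundles I) (s : seq int)
    : Prop :=
  size s = items I /\
  forall (i : 'I_(agents I)) (o : 'I_(items I)), (o \in A i) = (s`_o == i%:Z).

(* Main.v *)
(** Allocate the items one by one, in any order.  EQ1 is preserved if item o
    goes to an agent p such that p is a poorest agent when v_p(o) > 0 and a
    richest one when v_p(o) < 0: removing o restores the comparisons that o
    spoils.  Such a p is found by one scan of the agents: keep a candidate p,
    replace it by a poorer agent if v_p(o) > 0 and by a richer one if
    v_p(o) < 0.  As o is an objective good or chore, the new candidate never has
    a value of the wrong sign, and a candidate of value 0 can be kept for good.

    On a random access machine this takes O(nm) steps on integers of O(nm + L)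
    bits, where L is the largest bit length in the input. *)
Require Import Defs.
From mathcomp Require Import all_boot all_order all_algebra.
From mathcomp Require Import zify.

Set Implicit Arguments.
Unset Strict Implicit.
Unset Printing Implicit Defensive.

Import Order.TTheory GRing.Theory Num.Theory.

(** * Allocating one more item *)

Definition give (I : instance) (A : bundles I) (p : 'I_(agents I))
    (o : 'I_(items I)) : bundles I :=
  fun i => if i == p then o |: A i else A i.

Lemma bundle_valueU1 (I : instance) (i : 'I_(agents I)) o (S : {set _}) :
  o \notin S -> bundle_value i (o |: S) = (value i o + bundle_value i S)%R.
Proof. by move=> oS; rewrite /bundle_value big_setU1. Qed.

(** Only pairs containing p change. Where o spoils a comparison, o itself is the witness. Elsewhere
    the strict inequality already held for [A], and its old witness survives because o shifts the
    value of p in the favourable direction. *)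
Lemma EQ1_give (I : instance) (A : bundles I) p o :
  EQ1 A -> o \notin A p ->
  (0 < value p o -> forall i, bundle_value p (A p) <= bundle_value i (A i))%R ->
  (value p o < 0 -> forall i, bundle_value i (A i) <= bundle_value p (A p))%R ->
  EQ1 (give A p o).
Proof.
move=> eqA oAp poorest richest i j; rewrite /give.
have neq_o x : x \in A p -> x != o by apply: contraTneq => ->.
have oD x : o \notin A p :\ x by rewrite in_setD1 (negPf oAp) andbF.
have UD x : x \in A p -> (o |: A p) :\ x = o |: (A p :\ x).
  move=> /neq_o xo; apply/setP=> y; rewrite !inE.
  by case: (eqVneq y o) => // ->; rewrite eq_sym xo.
have [->|ip] := eqVneq i p; have [->|jp] := eqVneq j p.
- by rewrite ltxx.
(* Here p is the poorer side, so only a chore o can do harm; in the mirror case below p is the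
   richer side and only a good can. *)
- rewrite bundle_valueU1 // => lt_pj; have [v_lt0|v_ge0] := ltP (value p o) 0%R.
    by right; exists o; rewrite setU11 setU1K // ltW // richest.
  case: (eqA p j) => [|[g [gA vg le_g]]|[c [cA vc le_c]]]; first by lia.
    by left; exists g; split=> //; lia.
  right; exists c; rewrite in_setU1 cA orbT UD // bundle_valueU1 //.
  by split=> //; lia.
- rewrite bundle_valueU1 // => lt_ip; have [v_le0|v_gt0] := leP (value p o) 0%R.
    case: (eqA i p) => [|[g [gA vg le_g]]|[c [cA vc le_c]]]; first by lia.
      left; exists g; rewrite in_setU1 gA orbT UD // bundle_valueU1 //.
      by split=> //; lia.
    by right; exists c; split=> //; lia.
  by left; exists o; rewrite setU11 setU1K // ltW // poorest.
- exact: eqA.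
Qed.

(** * Time bounds from step counts *)

(* At most T steps, whatever their cost. *)
Fixpoint halts (P : ram_program) (T : nat) (s : ram_state) (Q : seq int -> Prop)
    : Prop :=
  size P <= ram_pc s /\ Q (ram_out s) \/
  if T is T'.+1 then
    exists c s', ram_step P s = Some (c, s') /\ halts P T' s' Q
  else False.

Lemma halts_stop P T s Q : size P <= ram_pc s -> Q (ram_out s) -> halts P T s Q.
Proof. by case: T => [|T]; left. Qed.

Lemma haltsS P T s Q : halts P T s Q -> halts P T.+1 s Q.
Proof.
elim: T s => [|T IHT] s /=; first by case=> // h; left.
by case=> [h|[c [s' [step_s h]]]]; [left | right; exists c, s'; split; last exact: IHT].
Qed.

(** Branches of different lengths can thus be charged the same number of steps. *)
Lemma halts_leq P T T' s Q : T <= T' -> halts P T s Q -> halts P T' s Q.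
Proof.
by move/subnKC=> <- h; elim: (T' - T) => [|d]; rewrite ?addn0 ?addnS //; apply: haltsS.
Qed.

Lemma bit_length_leq K z : 0 < K -> `|z| < 2 ^ K -> bit_length z <= K.
Proof.
move=> K_gt0 zK; rewrite /bit_length; have [->|z_gt0] := posnP `|z|%N.
  by rewrite trunc_log0.
by rewrite -(ltn_exp2l _ _ (ltnSn 1)) (leq_ltn_trans _ zK) // trunc_logP.
Qed.

Definition small_constants (K : nat) (P : ram_program) : bool :=
  all (fun c => if c is RConst _ z then `|z|%N < 2 ^ K else true) P.

(** The unread input is bounded too, since reading charges for the integer read and copies it into a
    register. *)
Definition small_state (K : nat) (s : ram_state) : Prop :=
  (forall k, `|ram_reg s k|%N < 2 ^ K) /\ all (fun z => `|z|%N < 2 ^ K) (ram_in s).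

Lemma small_set_reg K r i z :
  (forall k, `|r k|%N < 2 ^ K) -> `|z|%N < 2 ^ K.+1 ->
  forall k, `|set_reg r i z k|%N < 2 ^ K.+1.
Proof.
move=> rK zK k; rewrite /set_reg; case: eqP => // _.
by rewrite (ltn_trans (rK k)) // ltn_exp2l.
Qed.

(** An instruction pays for at most two operands, whence [K.*2]; only sums and differences create
    new integers, at the price of one extra bit. *)
Lemma ram_step_small P K s c s' :
  0 < K -> small_constants K P -> small_state K s -> ram_step P s = Some (c, s') ->
  c <= K.*2 /\ small_state K.+1 s'.
Proof.
move=> K_gt0 smallP; case: s => pc r inp out [/= rK inpK]; rewrite /ram_step /=.
case c_pc: (onth P pc) => [i|//].
have le2 z : `|z|%N < 2 ^ K -> `|z|%N < 2 ^ K.+1.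
  by move=> zK; rewrite (ltn_trans zK) // ltn_exp2l.
have lenK z : `|z|%N < 2 ^ K -> bit_length z <= K by exact: bit_length_leq.
have len2 y z : `|y|%N < 2 ^ K -> `|z|%N < 2 ^ K -> bit_length y + bit_length z <= K.*2.
  by move=> /lenK yK /lenK zK; rewrite -addnn leq_add.
have len1 z : `|z|%N < 2 ^ K -> bit_length z <= K.*2.
  by move=> /lenK /leq_trans-> //; rewrite -addnn leq_addr.
have sumK y z : `|y|%N < 2 ^ K -> `|z|%N < 2 ^ K ->
    `|(y + z)%R| < 2 ^ K.+1 /\ `|(y - z)%R| < 2 ^ K.+1 by rewrite expnS; lia.
have inK : all (fun z => `|z|%N < 2 ^ K.+1) inp by apply: sub_all inpK.
have reg2 k : `|r k|%N < 2 ^ K.+1 by exact: le2.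
case: i c_pc => [i z|i j k|i j k|i j|i j|l j|i|i] c_pc /=.
- have zK : `|z|%N < 2 ^ K.
    have := elimT (all_nthP (RConst 0 0%R)) smallP pc.
    by rewrite -onthTE c_pc (onth_nth _ _ _ _ c_pc); apply.
  by move=> [<- <-]; split; [exact: len1 | split=> //=; exact/small_set_reg/le2].
- have [? ?] := sumK _ _ (rK j) (rK k).
  by move=> [<- <-]; split; [exact: len2 | split=> //=; exact: small_set_reg].
- have [? ?] := sumK _ _ (rK j) (rK k).
  by move=> [<- <-]; split; [exact: len2 | split=> //=; exact: small_set_reg].
- case rj: (r j) => [a|//] [<- <-]; rewrite -rj; split; first exact: len2.
  by split=> //=; exact: small_set_reg.
- case ri: (r i) => [a|//] [<- <-]; rewrite -ri; split; first exact: len2.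
  by split=> //=; exact: small_set_reg.
- by move=> [<- <-]; split; first exact: len1.
- case: inp inpK inK => // z inp' /= /andP[zK _] /andP[zK' inK'] [<- <-].
  by split; [exact: len1 | split=> //=; exact: small_set_reg].
- by move=> [<- <-]; split; first exact: len1.
Qed.

(* Since only sums and differences can be computed, register contents gain at
   most one bit per step; a bound on the number of steps is all that is needed. *)
Lemma halts_ram_run P K T s Q :
  0 < K -> small_constants K P -> small_state K s -> halts P T s Q ->
  exists t out, [/\ ram_run P s t out, t <= T * (K + T).*2 & Q out].
Proof.
elim: T K s => [|T IHT] K s K_gt0 smallP smalls /=; case.
- by case=> szP Qs; exists 0, (ram_out s); split=> //; apply: RamHalt.
- by [].
- by case=> szP Qs; exists 0, (ram_out s); split=> //; apply: RamHalt.
case=> [c [s' [step_s h]]].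
have [cK smalls'] := ram_step_small K_gt0 smallP smalls step_s.
have smallP' : small_constants K.+1 P.
  apply: sub_all smallP; case=> // _ z zK.
  by rewrite (ltn_trans zK) // ltn_exp2l.
have [t [out [run_s' tT Qout]]] := IHT _ _ (ltn0Sn K) smallP' smalls' h.
exists (c + t), out; split=> //; first exact: RamStep run_s'.
(* As [K.+1 + T] is [K + T.+1], the width reached at the end bounds the cost of this step and of all
   later ones. *)
move: tT; rewrite addSnnS => tT; rewrite mulSn leq_add //.
by rewrite (leq_trans cK) // leq_double leq_addr.
Qed.

(** * The program *)

Lemma set_reg_eq r i z : set_reg r i z i = z.
Proof. by rewrite /set_reg eqxx. Qed.

Lemma set_reg_neq r i z k : k != i -> set_reg r i z k = r k.
Proof. by rewrite /set_reg => /negPf->. Qed.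

(** * Symbolic execution of single instructions *)

Section Steps.
Variables (P : ram_program) (T pc : nat) (r : nat -> int) (inp out : seq int).
Variable Q : seq int -> Prop.
Let start := RamState pc r inp out.

Lemma halts_const i z :
  onth P pc = Some (RConst i z) ->
  halts P T (RamState pc.+1 (set_reg r i z) inp out) Q -> halts P T.+1 start Q.
Proof. by move=> c_pc h; right; do 2!eexists; rewrite /ram_step /= c_pc. Qed.

(** Operands enter through equations, so the new register file records evaluated values instead of
    lookups in nested [set_reg]. *)
Lemma halts_add i j k y z :
  onth P pc = Some (RAdd i j k) -> r j = y -> r k = z ->
  halts P T (RamState pc.+1 (set_reg r i (y + z)%R) inp out) Q ->
  halts P T.+1 start Q.
Proof. by move=> c_pc <- <- h; right; do 2!eexists; rewrite /ram_step /= c_pc. Qed.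

Lemma halts_sub i j k y z :
  onth P pc = Some (RSub i j k) -> r j = y -> r k = z ->
  halts P T (RamState pc.+1 (set_reg r i (y - z)%R) inp out) Q ->
  halts P T.+1 start Q.
Proof. by move=> c_pc <- <- h; right; do 2!eexists; rewrite /ram_step /= c_pc. Qed.

Lemma halts_load i j a z :
  onth P pc = Some (RLoad i j) -> r j = Posz a -> r a = z ->
  halts P T (RamState pc.+1 (set_reg r i z) inp out) Q ->
  halts P T.+1 start Q.
Proof.
move=> c_pc rj <- h; right; do 2!eexists; rewrite /ram_step /= c_pc /= rj.
by split; last exact: h.
Qed.

Lemma halts_store i j a z :
  onth P pc = Some (RStore i j) -> r i = Posz a -> r j = z ->
  halts P T (RamState pc.+1 (set_reg r a z) inp out) Q ->
  halts P T.+1 start Q.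
Proof.
move=> c_pc ri <- h; right; do 2!eexists; rewrite /ram_step /= c_pc /= ri.
by split; last exact: h.
Qed.

Lemma halts_jump l j z :
  onth P pc = Some (RJumpPos l j) -> r j = z -> (0 < z)%R ->
  halts P T (RamState l r inp out) Q -> halts P T.+1 start Q.
Proof.
by move=> c_pc <- rj h; right; do 2!eexists; rewrite /ram_step /= c_pc /= rj.
Qed.

Lemma halts_nojump l j z :
  onth P pc = Some (RJumpPos l j) -> r j = z -> (z <= 0)%R ->
  halts P T (RamState pc.+1 r inp out) Q -> halts P T.+1 start Q.
Proof.
move=> c_pc <- rj h; right; do 2!eexists; rewrite /ram_step /= c_pc /=.
by rewrite ltNge rj.
Qed.

Lemma halts_print i z :
  onth P pc = Some (RPrint i) -> r i = z ->
  halts P T (RamState pc.+1 r inp (rcons out z)) Q -> halts P T.+1 start Q.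
Proof. by move=> c_pc <- h; right; do 2!eexists; rewrite /ram_step /= c_pc. Qed.

End Steps.

Lemma halts_read P T pc r z inp out Q i :
  onth P pc = Some (RRead i) ->
  halts P T (RamState pc.+1 (set_reg r i z) inp out) Q ->
  halts P T.+1 (RamState pc r (z :: inp) out) Q.
Proof. by move=> c_pc h; right; do 2!eexists; rewrite /ram_step /= c_pc. Qed.

(* The utility of agent i is kept in register 16 + i, and v_i(o) in register
   16 + n + (i * m + o).  The test m > 0 must come first: without items, n is not
   polynomially bounded in the size of the input.  Comments label jump targets. *)
Definition greedy : ram_program :=
  let n := 0 in let m := 1 in let one := 2 in let zero := 3 in let base := 4 in
  let c := 5 in let k := 6 in let u := 7 in let v := 8 in let v0 := 9 in
  let best := 10 in let y := 11 in let owner := 12 in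
  let t := 13 in let d := 14 in let yneg := 15 in
  [:: RRead n;
      RRead m;
      RConst one 1;
      RConst base 16;
      RJumpPos 6 m;
      RJumpPos 45 one;
      RAdd c n zero;
      RAdd k k m; (* 7: *)
      RSub c c one;
      RJumpPos 7 c;
      RAdd v0 base n;
      RAdd v v0 zero;
      RRead t; (* 12: *)
      RStore v t;
      RAdd v v one;
      RSub k k one;
      RJumpPos 12 k;
      RAdd k m zero;
      RAdd c n zero; (* 18: *)
      RAdd u base zero;
      RAdd v v0 zero;
      RLoad best u; (* 21: *)
      RLoad y v;
      RAdd owner u zero;
      RAdd u u one; (* 24: *)
      RAdd v v m;
      RSub c c one;
      RJumpPos 29 c;
      RJumpPos 38 one;
      RLoad t u; (* 29: *)
      RSub d t best;
      RSub yneg zero y;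
      RJumpPos 36 yneg;
      RSub d best t;
      RJumpPos 36 y;
      RJumpPos 24 one;
      RJumpPos 21 d; (* 36: *)
      RJumpPos 24 one;
      RAdd best best y; (* 38: *)
      RStore owner best;
      RSub owner owner base;
      RPrint owner;
      RAdd v0 v0 one;
      RSub k k one;
      RJumpPos 18 k].

(** Scratch registers are numbered below 16 and tables start at 16, so arithmetic alone separates
    their addresses. *)
Local Ltac lookup :=
  repeat first [rewrite set_reg_eq | rewrite set_reg_neq; last (by [] || lia)];
  first [eassumption | reflexivity].
Local Ltac add := apply: halts_add; [reflexivity | lookup | lookup | ].
Local Ltac sub := apply: halts_sub; [reflexivity | lookup | lookup | ].
Local Ltac load := apply: halts_load; [reflexivity | lookup | lookup | ].
Local Ltac store := apply: halts_store; [reflexivity | lookup | lookup | ].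
Local Ltac jump := apply: halts_jump; [reflexivity | lookup | (by [] || lia) | ].
Local Ltac nojump := apply: halts_nojump; [reflexivity | lookup | (by [] || lia) | ].
Local Ltac regs := rewrite /set_reg /=; lia.

(** * Correctness and running time *)

(** The machine cannot multiply, so nm is found by repeated addition, three steps a turn. As in the
    later loop rules, the continuation knows the final registers only through the promised values
    and a frame condition. *)
Lemma halts_product c m a r inp out T Q :
  r 5 = Posz c.+1 -> r 1 = Posz m -> r 2 = 1%R -> r 6 = Posz a ->
  (forall r', r' 6 = Posz (a + m * c.+1) ->
     (forall k, k \notin [:: 5; 6] -> r' k = r k) ->
     halts greedy T (RamState 10 r' inp out) Q) ->
  halts greedy (T + 3 * c.+1) (RamState 7 r inp out) Q.
Proof.
elim: c a r => [|c IHc] a r r5 r1 r2 r6 post; rewrite mulnS addnCA.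
  add; sub; nojump; rewrite addn0; apply: post; first by rewrite muln1; regs.
  by move=> k; rewrite /set_reg; do 2![case: eqP => [->|_] //].
add; sub; jump.
apply: (IHc (a + m)); [by regs | by regs | by regs | by regs |].
move=> r' r'6 pres; apply: post; first by rewrite r'6 [m * c.+2]mulnS addnA.
move=> k hk; rewrite pres //; move: hk; rewrite /set_reg.
by do 2![case: eqP => [->|_] //].
Qed.

(** Invariant: j values are stored from address b on, and the rest is still unread. The loop tests
    at its end, so it needs a nonempty input. *)
Lemma halts_read_values vals b : forall inp r j out T Q,
  0 < size inp -> b >= 16 -> drop j vals = inp ->
  r 2 = 1%R -> r 6 = Posz (size inp) -> r 8 = Posz (b + j) ->
  (forall k, k < j -> r (b + k) = (vals`_k)%R) ->
  (forall r', (forall k, k < size vals -> r' (b + k) = (vals`_k)%R) ->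
     (forall k, k \notin [:: 6; 8; 13] -> k < b -> r' k = r k) ->
     halts greedy T (RamState 17 r' [::] out) Q) ->
  halts greedy (T + 5 * size inp) (RamState 12 r inp out) Q.
Proof.
elim=> [//|z inp IHinp] r j out T Q _ b16 def_inp r2 r6 r8 mem_r post.
have j_vals : j < size vals by case: ltnP => // /drop_oversize; rewrite def_inp.
have [def_z def_inp'] : z = (vals`_j)%R /\ drop j.+1 vals = inp.
  by move: def_inp; rewrite (drop_nth 0%R) // => -[].
rewrite [size (_ :: _)]/= mulnS addnCA; move def_T1: (T + _) => T1.
apply: halts_read; [reflexivity|]; store; add; sub.
have bjF k : k < b -> (k == b + j) = false by lia.
set r1 := set_reg _ 6 _.
have r1_mem k : k < j.+1 -> r1 (b + k) = (vals`_k)%R.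
  rewrite ltnS leq_eqVlt /r1 => /predU1P[->|kj].
    by rewrite 2?set_reg_neq ?set_reg_eq //; lia.
  by rewrite 4?set_reg_neq ?mem_r //; lia.
have r1_pres k : k \notin [:: 6; 8; 13] -> k < b -> r1 k = r k.
  by rewrite /r1 /set_reg => k_notin /bjF->; move: k_notin; do 3![case: eqP => [->|_] //].
have r1_6 : r1 6 = Posz (size inp) by rewrite /r1 set_reg_eq /=; lia.
have r1_8 : r1 8 = Posz (b + j.+1).
  by rewrite /r1 set_reg_neq // set_reg_eq; lia.
have r1_2 : r1 2 = 1%R by rewrite r1_pres //; lia.
clearbody r1.
case: inp IHinp def_inp' r6 r1_6 def_T1 {def_inp} => [|z' inp']
  IHinp def_inp' r6 r1_6 <-.
  nojump; rewrite addn0; apply: post => // k k_vals; apply: r1_mem.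
  have : size (drop j.+1 vals) = 0 by rewrite def_inp'.
  by rewrite size_drop; lia.
jump; apply: IHinp r1_8 r1_mem _ => // r' r'_mem r'_pres.
by apply: post => // k kF kb; rewrite r'_pres ?r1_pres.
Qed.

(** Reads the output printed so far as a partial allocation. The test [o < size s] matters: the
    default 0 of [nth] would give every pending item to agent 0. *)
Definition owned (I : instance) (s : seq int) : bundles I :=
  fun i => [set o : 'I_(items I) | (o < size s) && (s`_o == i%:Z)%R].
Arguments owned : clear implicits.

Record memory (I : instance) (r : nat -> int) (s : seq int) : Prop := Memory {
  mem_agents : r 0 = Posz (agents I);
  mem_items : r 1 = Posz (items I);
  mem_one : r 2 = 1%R;
  mem_zero : r 3 = 0%R;
  mem_base : r 4 = Posz 16;
  mem_utility (i : 'I_(agents I)) : r (16 + i) = bundle_value i (owned I s i);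
  mem_value (i : 'I_(agents I)) (o : 'I_(items I)) :
    r (16 + agents I + (i * items I + o)) = value i o }.

(** The condition of [EQ1_give] on the recipient, restricted to the agents below b, that is, those
    already scanned. *)
Definition preferred (I : instance) (u : 'I_(agents I) -> int) (o : 'I_(items I))
    (b : nat) (p : 'I_(agents I)) : Prop :=
  forall j : 'I_(agents I), j < b ->
    ((0 < value p o -> u p <= u j) /\ (value p o < 0 -> u j <= u p))%R.

Record candidate (I : instance) (r : nat -> int) (s : seq int)
    (o : 'I_(items I)) (b : nat) (p : 'I_(agents I)) : Prop := Candidate {
  cand_mem : memory I r s;
  cand_item : r 6 = Posz (items I - o);
  cand_column : r 9 = Posz (16 + agents I + o);
  cand_utility : r 10 = bundle_value p (owned I s p);
  cand_value : r 11 = value p o;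
  cand_address : r 12 = Posz (16 + p);
  cand_preferred :
    preferred (fun i => bundle_value i (owned I s i)) o b p }.

(** Serves both to install agent 0 as first candidate and to replace a candidate during the scan. *)
Lemma halts_switch I r s (o : 'I_(items I)) (i : 'I_(agents I)) inp T Q :
  memory I r s -> r 6 = Posz (items I - o) -> r 9 = Posz (16 + agents I + o) ->
  r 7 = Posz (16 + i) -> r 8 = Posz (16 + agents I + (i * items I + o)) ->
  preferred (fun i => bundle_value i (owned I s i)) o i.+1 i ->
  (forall r', candidate r' s o i.+1 i -> r' 5 = r 5 -> r' 7 = r 7 -> r' 8 = r 8 ->
     halts greedy T (RamState 24 r' inp s) Q) ->
  halts greedy T.+3 (RamState 21 r inp s) Q.
Proof.
move=> mem_r r6 r9 r7 r8 pref post; have [? ? ? r3 ? mem_u mem_v] := mem_r.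
have ui := mem_u i; have vi := mem_v i o.
do 2!load; add; apply: post; try by regs.
by split=> //; regs.
Qed.

(** If p values o positively then o is an objective good, so i can only be required to be poorest,
    and it is poorer than p, a poorest agent so far. The negative case is dual. *)
Lemma preferred_switch I (u : 'I_(agents I) -> int) o (p i : 'I_(agents I)) :
  objective_good o \/ objective_chore o -> preferred u o i p ->
  (value p o < 0 -> u p < u i)%R -> (0 < value p o -> u i < u p)%R ->
  value p o <> 0%R -> preferred u o i.+1 i.
Proof.
move=> obj pref chore good nz j; rewrite ltnS leq_eqVlt => /orP[/eqP/val_inj->|].
  by split; rewrite lexx.
move=> /pref [good_j chore_j].
case: obj => obj; have := obj p; have := obj i; lia.
Qed.

Lemma preferred_keep I (u : 'I_(agents I) -> int) o (p i : 'I_(agents I)) :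
  preferred u o i p ->
  (value p o < 0 -> u i <= u p)%R -> (0 < value p o -> u p <= u i)%R ->
  preferred u o i.+1 p.
Proof.
move=> pref chore good j; rewrite ltnS leq_eqVlt => /orP[/eqP/val_inj->|] //.
exact: pref.
Qed.

Lemma halts_next I s (o : 'I_(items I)) T Q :
  objective_good o \/ objective_chore o ->
  (forall r' p, candidate r' s o (agents I) p ->
     halts greedy T (RamState 38 r' [::] s) Q) ->
  forall d (i p : 'I_(agents I)) r, agents I = i + d.+1 ->
    candidate r s o i.+1 p -> r 5 = Posz d.+1 -> r 7 = Posz (16 + i) ->
    r 8 = Posz (16 + agents I + (i * items I + o)) ->
    halts greedy (T + 16 * d.+1) (RamState 24 r [::] s) Q.
Proof.
move=> obj post; elim=> [|d IHd] i p r nE cand r5 r7 r8.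
  have [[r0 r1 r2 r3 ? mem_u mem_v] r6 r9 r10 r11 r12 pref] := cand.
  apply: (@halts_leq _ (5 + T)); first lia.
  do 2!add; sub; nojump; jump; apply: (post _ p).
  split=> //; try by regs.
  by move=> j _; apply: pref; have := ltn_ord j; lia.
(* The longest of the five paths through the loop, replacing p when it values o positively, takes 14
   steps; [haltsS] pads the others. *)
apply: (@halts_leq _ (14 + (T + 16 * d.+1))); first lia.
have Si_n : i.+1 < agents I by lia.
pose i' := Ordinal Si_n.
have [[r0 r1 r2 r3 r4 mem_u mem_v] r6 r9 r10 r11 r12 pref] := cand.
do 2!add; sub; jump; set r' := set_reg _ 5 _.
have cand' : candidate r' s o i' p by split=> //; regs.
have {r5} r'5 : r' 5 = Posz d.+1 by rewrite /r'; regs.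
have {r7} r'7 : r' 7 = Posz (16 + i') by rewrite /r' /i'; regs.
have {r8} r'8 : r' 8 = Posz (16 + agents I + (i' * items I + o)).
  by rewrite /r' /set_reg /= mulSn; lia.
clearbody r' => {r0 r1 r2 r3 r4 mem_u mem_v r6 r9 r10 r11 r12 pref cand r}.
have [[r0 r1 r2 r3 r4 mem_u mem_v] r6 r9 r10 r11 r12 pref] := cand'.
have ui := mem_u i'.
have nE' : agents I = i' + d.+1 by rewrite {1}nE addSnnS.
have keep r'' : candidate r'' s o i'.+1 p -> r'' 5 = r' 5 -> r'' 7 = r' 7 ->
    r'' 8 = r' 8 -> halts greedy (T + 16 * d.+1) (RamState 24 r'' [::] s) Q.
  by move=> cand5 e5 e7 e8; apply: (IHd i' p) => //; congruence.
have switch r'' : memory I r'' s -> r'' 6 = r' 6 -> r'' 9 = r' 9 ->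
    r'' 5 = r' 5 -> r'' 7 = r' 7 -> r'' 8 = r' 8 ->
    preferred (fun i => bundle_value i (owned I s i)) o i'.+1 i' ->
    halts greedy (T + 16 * d.+1).+3 (RamState 21 r'' [::] s) Q.
  move=> mem_r'' e6 e9 e5 e7 e8 pref''.
  apply: (halts_switch (o := o) (i := i')) => //; try congruence.
  by move=> r3' cand3 f5 f7 f8; apply: (IHd i' i') => //; congruence.
(* Register 14 receives the utility of [i'] minus that of p if p values o negatively, and the
   opposite if positively: it is positive exactly when [i'] must replace p. For value 0 the test is
   skipped. *)
load; do 2!sub; case: (ltgtP (value p o) 0%R) => v_p.
- jump; have [le_u|lt_u] :=
    lerP (bundle_value i' (owned I s i')) (bundle_value p (owned I s p)).
    nojump; jump; do 4!apply: haltsS; apply: keep => //; split=> //.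
    by apply: (preferred_keep (i := i') pref) => /=; lia.
  jump; do 2!apply: haltsS; apply: switch => //.
  by apply: (preferred_switch (i := i') _ pref) => //=; lia.
- nojump; sub; jump; have [le_u|lt_u] :=
    lerP (bundle_value p (owned I s p)) (bundle_value i' (owned I s i')).
    nojump; jump; do 2!apply: haltsS; apply: keep => //; split=> //.
    by apply: (preferred_keep (i := i') pref) => /=; lia.
  jump; apply: switch => //.
  by apply: (preferred_switch (i := i') _ pref) => //=; lia.
- nojump; sub; nojump; jump; do 3!apply: haltsS; apply: keep => //; split=> //.
  by apply: (preferred_keep (i := i') pref) => /=; lia.
Qed.

(** * The loop over the items *)

Lemma bundle_value_owned_nil (I : instance) (i : 'I_(agents I)) :
  bundle_value i (owned I [::] i) = 0%R.
Proof. by rewrite /bundle_value big1 // => o; rewrite inE. Qed.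

Lemma EQ1_owned_nil (I : instance) : EQ1 (owned I [::]).
Proof. by move=> i j; rewrite !bundle_value_owned_nil. Qed.

Lemma owned_rcons (I : instance) s (o : 'I_(items I)) (p : 'I_(agents I)) :
  o = size s :> nat -> owned I (rcons s (Posz p)) =1 give (owned I s) p o.
Proof.
move=> oE i; apply/setP=> x.
have -> : (x \in give (owned I s) p o i) = (x == o) && (i == p) || (x \in owned I s i).
  by rewrite /give; case: (i == p); rewrite ?inE ?andbT ?andbF.
rewrite !inE size_rcons nth_rcons ltnS leq_eqVlt -oE -val_eqE /=.
by case: ltngtP => //= _; rewrite orbF eqz_nat val_eqE eq_sym.
Qed.

Definition EQ1_output (I : instance) (out : seq int) : Prop :=
  exists A : bundles I, [/\ complete_allocation A, EQ1 A & encodes_allocation A out].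

Definition owners (I : instance) (s : seq int) : Prop :=
  forall z, z \in s -> exists i : 'I_(agents I), z = Posz i.

(** One entry per item makes the bundles disjoint; they cover all items because every entry names an
    actual agent. *)
Lemma EQ1_output_owned I s :
  size s = items I -> owners I s -> EQ1 (owned I s) -> EQ1_output I s.
Proof.
move=> szs own eqs; have o_lt (o : 'I_(items I)) : o < size s by rewrite szs.
exists (owned I s); split=> //; last by split=> // i o; rewrite inE o_lt.
split=> [i j ij|].
  rewrite disjoints_subset; apply/subsetP=> o; rewrite !inE !o_lt => /eqP->.
  by rewrite eqz_nat.
apply/eqP; rewrite eqEsubset subsetT; apply/subsetP=> o _.
have [i si] := own _ (mem_nth 0%R (o_lt o)).
by apply/bigcupP; exists i => //; rewrite inE o_lt si eqxx.
Qed.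

Lemma halts_items (I : instance) : 0 < agents I -> objective_valuations I ->
  forall d s r, items I = size s + d.+1 -> memory I r s -> r 6 = Posz d.+1 ->
    r 9 = Posz (16 + agents I + size s) -> EQ1 (owned I s) -> owners I s ->
    halts greedy (d.+1 * (16 * agents I + 16)) (RamState 18 r [::] s) (EQ1_output I).
Proof.
(* The exit test comes last, so the body is executed before [d] is split; strong induction allows
   this. *)
move=> n_gt0 obj; elim/ltn_ind=> d IHd s r mE mem_r r6 r9 eqs own.
have s_lt : size s < items I by lia.
pose o := Ordinal s_lt; pose i0 := Ordinal n_gt0; set W := 16 * agents I + 16.
have [r0 r1 r2 r3 r4 mem_u mem_v] := mem_r.
(* Three steps set up the scan, three install agent 0, 16n cover the scan and seven the update,
   output and exit test. *)
apply: (@halts_leq _ (3 + (7 + d * W + 16 * agents I).+3)).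
  by rewrite mulSn /W; lia.
do 3!add; apply: (halts_switch (o := o) (i := i0)); try by regs.
- by split.
- move=> j; rewrite ltnS leqn0 => /eqP j0.
  by have -> : j = i0 by [exact: val_inj]; rewrite lexx.
move=> {}r' cand r'5 r'7 r'8; rewrite -{1}(prednK n_gt0).
apply: (halts_next (o := o) _ _ _ cand).
- exact: obj.
- move=> {cand r'5 r'7 r'8}r' p [mem_r' r'6 r'9 r'10 r'11 r'12 pref].
  have pF k : (16 + agents I + k == 16 + p) = false by have := ltn_ord p; lia.
  have oA : o \notin owned I s p by rewrite inE ltnn.
  have [r'0 r'1 r'2 r'3 r'4 mem_u' mem_v'] := mem_r'.
  have eqs' : EQ1 (owned I (rcons s (Posz p))).
    have eq_give : EQ1 (give (owned I s) p o).
      by apply: EQ1_give => // v_p i; have [] := pref i (ltn_ord i); auto.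
    by move=> i j; rewrite !(owned_rcons (o := o)) //; apply: eq_give.
  have own' : owners I (rcons s (Posz p)).
    by move=> z; rewrite mem_rcons inE => /predU1P[->|/own //]; exists p.
  add; store; sub; apply: halts_print; [reflexivity | lookup |]; add; sub.
  (* The scan keeps the address of the owner's utility; subtracting the base yields the agent to
     print. *)
  have -> : (Posz (16 + p) - 16%Z)%R = Posz p by lia.
  set r'' := set_reg _ 6 _.
  have r''_6 : r'' 6 = Posz d by rewrite /r''; regs.
  have r''_9 : r'' 9 = Posz (16 + agents I + size (rcons s (Posz p))).
    by rewrite size_rcons /r'' set_reg_neq // set_reg_eq /=; lia.
  have mem_r'' : memory I r'' (rcons s (Posz p)).
    split=> // [i|i o']; last first.
      by rewrite /r'' /set_reg pF /= mem_v'.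
    rewrite (owned_rcons (o := o)) // /give; case: eqVneq => [->|ip].
      by rewrite bundle_valueU1 // addrC /r'' /set_reg eqxx.
    by rewrite /r'' /set_reg eqn_add2l val_eqE (negPf ip) /= mem_u'.
  clearbody r''; case: d IHd mE {r6} r''_6 => [|d] IHd mE r''_6.
    nojump; apply: halts_stop => //; apply: EQ1_output_owned => //.
    by rewrite size_rcons mE addn1.
  by jump; apply: IHd => //; rewrite size_rcons addSnnS.
- by rewrite /= prednK.
- by rewrite r'5 /set_reg /=; lia.
- by rewrite r'7; regs.
- by rewrite r'8; regs.
Qed.

(** * Initialization and the whole run *)

Lemma nth_allpairs (S T R : Type) (f : S -> T -> R) x0 y0 z0 s t i j :
  i < size s -> j < size t ->
  nth z0 [seq f x y | x <- s, y <- t] (i * size t + j) = f (nth x0 s i) (nth y0 t j).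
Proof.
move=> + j_lt; elim: s i => [//|x s IHs] [|i] /= i_lt; rewrite nth_cat size_map.
  by rewrite add0n j_lt (nth_map y0).
by rewrite mulSn -addnA ltnNge leq_addr /= addKn IHs.
Qed.

Lemma halts_greedy (I : instance) : 0 < agents I -> objective_valuations I ->
  halts greedy (50 * (agents I * items I) + 6) (ram_init (encode_instance I))
    (EQ1_output I).
Proof.
move=> n_gt0 obj; rewrite /ram_init /encode_instance.
set vals := [seq value i o | i <- _, o <- _]; set n := agents I; set m := items I.
apply: (@halts_leq _ (4 + (50 * (n * m) + 2))); first lia.
apply: halts_read; [reflexivity|]; apply: halts_read; [reflexivity|].
apply: halts_const; [reflexivity|]; apply: halts_const; [reflexivity|].
set r := set_reg _ 4 _.
have [m0|m_gt0] := posnP m.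
  apply: (@halts_leq _ 2); first lia.
  have r1 : r 1 = 0%R by rewrite /r /set_reg /= m0.
  nojump; jump; apply: halts_stop => //; apply: EQ1_output_owned => //.
  exact: EQ1_owned_nil.
have szV : size vals = n * m by rewrite size_allpairs -!cardE !card_ord.
have nm_gt0 : 0 < n * m by rewrite muln_gt0 n_gt0.
(* Past the 3n steps of the product and the 5nm of reading come the items; all terms are multiples
   of nm up to a constant, since n and m are at most nm once both are positive. *)
apply: (@halts_leq _ (2 + ((2 + ((m * (16 * n + 16)).+1 + 5 * (n * m))) + 3 * n))).
  have : n <= n * m by rewrite leq_pmulr.
  have : m <= n * m by rewrite leq_pmull.
  by rewrite mulnDr [m * (16 * n)]mulnCA (mulnC m n); lia.
have r0 : r 0 = Posz n by [].
have r1 : r 1 = Posz m by [].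
have rF k : k \notin [:: 0; 1; 2; 4] -> r k = 0%R.
  by rewrite /r /set_reg; do 4![case: eqP => [->|_] //].
have r2 : r 2 = 1%R by [].
have r4 : r 4 = Posz 16 by [].
have r3 : r 3 = 0%R by [].
have r6 : r 6 = Posz 0 by [].
clearbody r; jump; add; have -> : 3 * n = 3 * n.-1.+1 by rewrite prednK.
apply: (halts_product (m := m) (a := 0)); try by regs.
move=> r' r'6 r'F; rewrite add0n prednK // in r'6.
have [r'0 r'1 r'2 r'3] : [/\ r' 0 = Posz n, r' 1 = Posz m, r' 2 = 1%R & r' 3 = 0%R].
  by split; rewrite r'F.
have r'4 : r' 4 = Posz 16 by rewrite r'F.
(* Untouched registers hold 0, the utility of an empty bundle, so the utilities need no
   initialization. *)
have r'_zero k : 16 <= k -> r' k = 0%R.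
  move=> k16; rewrite r'F ?inE; last by lia.
  by rewrite set_reg_neq ?rF ?inE; lia.
do 2!add; rewrite -szV.
apply: (@halts_read_values vals (16 + n) _ _ 0); rewrite ?drop0 ?szV //; try by regs.
move=> r'' r''_mem r''_F.
have r''_eq k : k < 5 -> r'' k = r' k.
  by move=> k5; rewrite r''_F ?set_reg_neq ?inE //; lia.
have r''_9 : r'' 9 = Posz (16 + n + 0) by rewrite r''_F //; regs.
add; rewrite -(prednK m_gt0).
apply: halts_items => //=; rewrite ?prednK //.
- split=> [|||||i|i o]; rewrite set_reg_neq //; try by rewrite r''_eq.
    rewrite bundle_value_owned_nil r''_F ?inE; [|lia|].
      by rewrite !set_reg_neq ?r'_zero ?leq_addr //; lia.
    by rewrite ltn_add2l.
  rewrite r''_mem; last by have := ltn_ord i; have := ltn_ord o; nia.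
  have := nth_allpairs (@value I) i o 0%R (s := enum 'I_n) (t := enum 'I_m)
    (i := i) (j := o).
  by rewrite !size_enum_ord !nth_ord_enum; apply.
- by rewrite set_reg_eq !r''_eq // r'1 r'3 addr0.
- exact: EQ1_owned_nil.
Qed.

(** * The polynomial bound *)

Lemma bit_size_ge s : size s <= bit_size s.
Proof. by rewrite -sum1_size leq_sum. Qed.

Lemma lt_bit_size z s : z \in s -> `|z| < 2 ^ bit_size s.
Proof.
move=> zs; rewrite (leq_trans (trunc_log_ltn `|z| (ltnSn 1))) // leq_exp2l //.
by rewrite /bit_size (big_rem _ zs) leq_addr.
Qed.

Theorem proposition3p2 :
  (forall I : instance, 0 < agents I -> objective_valuations I ->
     exists A : bundles I, complete_allocation A /\ EQ1 A) /\
  poly_time_solvable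
    (fun I : instance => 0 < agents I /\ objective_valuations I)
    encode_instance
    (fun (I : instance) (out : seq int) =>
       exists A : bundles I,
         [/\ complete_allocation A, EQ1 A & encodes_allocation A out]).
Proof.
set solvable := poly_time_solvable _ _ _; suff solve : solvable.
  split=> // I n_gt0 obj; have [P [p /(_ I (conj n_gt0 obj))]] := solve.
  by case=> [t [out [_ _ [A [complA eqA _]]]]]; exists A.
(* The bound [T * (K + T).*2] is used with [T = 50 * N] and [K = N + 5]; its second factor is 102N +
   10, at most 112N. *)
exists greedy, ((50 * 112)%:P * 'X^2)%R => I [n_gt0 obj].
set N := bit_size _.
(* Every input integer has at least one digit, and there are nm + 2 of them. *)
have N_ge : agents I * items I + 2 <= N.
  rewrite (leq_trans _ (bit_size_ge _)) //= size_allpairs -!cardE !card_ord.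
  by rewrite addn2.
have haltsN : halts greedy (50 * N) (ram_init (encode_instance I)) (EQ1_output I).
  by apply: halts_leq (halts_greedy n_gt0 obj); lia.
(* Inputs are below [2 ^ N]; the extra 5 bits make room for the program constants 1 and 16. *)
have [|||t [out [run_t le_t ok_out]]] := halts_ram_run (K := N + 5) _ _ _ haltsN.
- by rewrite addnS.
- have leN k : k < 2 ^ 5 -> k < 2 ^ (N + 5).
    by move=> /leq_trans-> //; rewrite leq_exp2l // leq_addl.
  by rewrite /small_constants /= !leN.
- split=> [k|]; first by rewrite expn_gt0.
  apply/allP=> z /lt_bit_size /leq_trans-> //.
  by rewrite leq_exp2l // leq_addr.
exists t, out; split=> //; rewrite (leq_trans le_t) // hornerCM hornerXn.
change (50 * N * (N + 5 + 50 * N).*2 <= 50 * 112 * (N * N)).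
have : (N + 5 + 50 * N).*2 <= 112 * N by lia.
by move=> /(leq_mul (leqnn (50 * N)))/leq_trans->//; rewrite mulnACA.
Qed.
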